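(* Let $\lambda>0$, let $(p_n)_{n\ge1}$ be a sequence in $[0,1]$ with $np_n\to\lambda$ as $n\to\infty$, and for each $n$ let $G_n$ be an Erdős–Rényi random graph $G(n,p_n)$. Then, with high probability, $$\limsup_{n\to\infty}\frac{\mathcal{E}(G_n)}{n}\;\le\; f(\lambda):=2\lambda e^{-2\lambda}+e^{-\lambda}\sqrt{3e^{-\lambda}+1}\,\sum_{k=2}^{\infty}\frac{\lambda^k\sqrt{k}}{k!};$$ that is, for every $\varepsilon>0$, $\lim_{n\to\infty}\mathbb{P}\left(\mathcal{E}(G_n)/n\le f(\lambda)+\varepsilon\right)=1$.
   Context: The energy $\mathcal{E}(G)$ of a finite simple graph $G$ is the sum of the absolute values of the eigenvalues (with multiplicity) of its adjacency matrix. $G(n,p)$ is the random simple graph on $n$ labeled vertices in which each of the $\binom n2$ possible edges is present independently with probability $p$. *)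

(* Defs.v *)
From HB Require Import structures.
From mathcomp Require Import all_boot all_order all_algebra.
From mathcomp Require Import polyrcf.
From mathcomp Require Import all_classical all_reals all_analysis.

Set Implicit Arguments.
Unset Strict Implicit.
Unset Printing Implicit Defensive.

Import Order.TTheory GRing.Theory Num.Theory.
Import numFieldNormedType.Exports.

Local Open Scope classical_set_scope.
Local Open Scope ring_scope.

Record sgraph (n : nat) := SGraph {
  adj :> rel 'I_n;
  adj_sym : symmetric adj;
  adj_irr : irreflexive adj }.

Definition adjmx (R : realType) (n : nat) (G : sgraph n) : 'M[R]_n :=
  \matrix_(i, j) (G i j)%:R.

(* The eigenvalues of a symmetric real matrix are all real, so the distinct
   real roots of the characteristic polynomial, taken with their
   multiplicities, are all the eigenvalues. *)
Definition energy (R : realType) (n : nat) (G : sgraph n) : R :=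
  let chi := char_poly (adjmx R G) in
  \sum_(x <- rootsR chi) `|x| *+ mup x chi.

Definition mutually_independent (R : realType) (d : measure_display)
    (T : measurableType d) (P : probability T R)
    (I : finType) (D : {set I}) (E : I -> set T) : Prop :=
  forall J : {set I}, J \subset D ->
    P (\bigcap_(i in [set` J]) E i) = (\prod_(i in J) fine (P (E i)))%:E.

(* An unordered pair of distinct vertices is encoded as (i, j) with i < j. *)
Definition vertex_pairs (n : nat) : {set 'I_n * 'I_n} :=
  [set e : 'I_n * 'I_n | (e.1 < e.2)%N]%SET.

Definition edge_event (T : Type) (n : nat) (G : T -> sgraph n)
    (e : 'I_n * 'I_n) : set T :=
  [set w | G w e.1 e.2].

Definition is_Gnp (R : realType) (d : measure_display) (T : measurableType d)
    (P : probability T R) (n : nat) (p : R) (G : T -> sgraph n) : Prop :=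
  [/\ forall e, e \in vertex_pairs n -> measurable (edge_event G e),
      forall e, e \in vertex_pairs n -> P (edge_event G e) = p%:E
    & mutually_independent P (vertex_pairs n) (edge_event G)].

Definition energy_bound (R : realType) (lambda : R) : R :=
  2 * lambda * expR (- (2 * lambda))
  + expR (- lambda) * Num.sqrt (3 * expR (- lambda) + 1)
    * limn (fun N : nat => \sum_(2 <= k < N) (lambda ^+ k * Num.sqrt k%:R / k`!%:R)).

(* Main.v *)
Require Import Defs.
From HB Require Import structures.
From mathcomp Require Import all_boot all_order all_algebra.
From mathcomp Require Import polyrcf complex.
From mathcomp Require Import all_classical all_reals all_analysis.
From mathcomp Require Import ring lra zify.

Set Implicit Arguments.
Unset Strict Implicit.
Unset Printing Implicit Defensive.

Import Order.TTheory GRing.Theory Num.Theory.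
Import numFieldNormedType.Exports.

Local Open Scope classical_set_scope.
Local Open Scope ring_scope.

(* Pendant edges are given to their non-leaf end.  Let L be the set of leaves
   whose neighbour is not a leaf; it is independent.  If B has the rows of the
   adjacency matrix A outside L, with the columns in L doubled, and zero rows
   in L, then A = (B + B^T) / 2.  The energy is tr(X A) = tr(X B) for the
   symmetric contraction X = sign A, so it is at most the sum of the Euclidean
   norms of the rows of B; the row of a vertex u of degree d with l leaf
   neighbours has norm at most sqrt(d + 3 l) if d > 1.
   By Cauchy-Schwarz in each degree class, the vertices of degree k contribute
   at most sqrt(N_k (k N_k + 3 S_k)), where N_k counts the vertices of degree k
   and S_k the pairs (vertex of degree k, adjacent leaf).  Toggling an edge
   changes N_k and S_k by a bounded amount, so Chebyshev with the Efron-Stein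
   variance bound concentrates them near their means, whose limits per vertex
   are e^-lambda lambda^k / k! and e^(-2 lambda) lambda^k / (k-1)!.  Markov's
   inequality takes care of the vertices of large degree. *)

(** * Expectation over independent Bernoulli variables *)

Section BernoulliExpectation.
Import boot.fintype boot.finset.
Local Open Scope set_scope.
Local Open Scope ring_scope.
Variables (R : realType) (I : finType) (p : R).
Implicit Types (s : seq I) (f g : {set I} -> R) (x A B : {set I}).

(* Expectation of [f x] when [x] contains each element of [s] independently
   with probability [p] and no other element. *)
Fixpoint bern_exp s f : R :=
  if s is e :: s' then
    bern_exp s' (fun x => p * f (e |: x)%SET + (1 - p) * f (x :\ e)%SET)
  else f set0.

Lemma eq_bern_exp s f g : f =1 g -> bern_exp s f = bern_exp s g.
Proof. by move=> fg; congr bern_exp; apply/funext. Qed.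

Lemma bern_expD s f g :
  bern_exp s (fun x => f x + g x) = bern_exp s f + bern_exp s g.
Proof.
elim: s f g => [//|e s IHs] f g /=; rewrite -IHs.
by apply: eq_bern_exp => x; ring.
Qed.

Lemma bern_expZ s (c : R) f :
  bern_exp s (fun x => c * f x) = c * bern_exp s f.
Proof.
elim: s f => [//|e s IHs] f /=; rewrite -IHs.
by apply: eq_bern_exp => x; ring.
Qed.

Lemma bern_exp_cst s (c : R) : bern_exp s (fun=> c) = c.
Proof.
elim: s => [//|e s IHs] /=; rewrite -[RHS]IHs.
by apply: eq_bern_exp => x; ring.
Qed.

Lemma bern_exp_sum s (J : finType) (P : pred J) (F : J -> {set I} -> R) :
  bern_exp s (fun x => \sum_(j | P j) F j x) = \sum_(j | P j) bern_exp s (F j).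
Proof.
elim: s F => [//|e s IHs] F /=; rewrite -IHs.
by apply: eq_bern_exp => x; rewrite !mulr_sumr -big_split.
Qed.

(** Induction on [s]: an element of [A] keeps only the branch of weight [p], an element of [B] only
    that of weight [1 - p]; for any other element both branches agree and the weights add up to
    1. *)
Lemma bern_exp_cylinder s A B : uniq s -> A :|: B \subset s ->
  A \subset ~: B ->
  bern_exp s (fun x => ((A \subset x) && (B \subset ~: x))%:R)
  = p ^+ #|A| * (1 - p) ^+ #|B|.
Proof.
elim: s A B => [|e s IHs] A B.
  move=> _ /subsetP AB0 _.
  have {}AB0 y : (y \in A) = false /\ (y \in B) = false.
    by have := AB0 y; rewrite inE in_nil; case: (y \in A);
      case: (y \in B) => //= /(_ isT).
  have -> : A = set0 by apply/setP => y; rewrite inE; case: (AB0 y).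
  have -> : B = set0 by apply/setP => y; rewrite inE; case: (AB0 y).
  by rewrite /= cards0 !sub0set !mulr1.
move=> /= /andP[es us] AB dAB.
have ABs y : y != e -> (y \in A) || (y \in B) -> y \in s.
  move=> ye yAB; have := subsetP AB y; rewrite !inE (negbTE ye) /=; exact.
have subU1 (C x : {set I}) : e \notin C -> (C \subset e |: x) = (C \subset x).
  move=> eC; rewrite -subDset; have -> // : C :\ e = C.
  by apply/setP => y; rewrite !inE; case: eqP => // ->; rewrite (negbTE eC).
have subD1 (C x : {set I}) : e \notin C -> (C \subset x :\ e) = (C \subset x).
  by move=> eC; rewrite subsetD1 eC andbT.
have setCU1 x : ~: (e |: x) = (~: x) :\ e.
  by apply/setP => y; rewrite !inE negb_or.
have setCD1 x : ~: (x :\ e) = e |: ~: x.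
  by apply/setP => y; rewrite !inE negb_and negbK.
have [eA|eA] := boolP (e \in A).
  have eB : e \notin B by have := subsetP dAB e eA; rewrite inE.
  rewrite (eq_bern_exp _
      (g := fun x => p * ((A :\ e \subset x) && (B \subset ~: x))%:R));
        last first.
    move=> x /=; rewrite setCU1 setCD1 (subU1 B)// (subD1 B)//
      -subDset subsetD1 eA andbF.
    by rewrite mulr0 addr0.
  rewrite bern_expZ IHs//.
  - by rewrite (cardsD1 e A) eA exprS mulrA.
  - apply/subsetP => y; rewrite !inE => yAB; apply: ABs.
      by apply: contraTneq yAB => ->; rewrite eqxx (negbTE eB).
    by case/orP: yAB => [/andP[_ ->//]|->]; rewrite orbT.
  - exact: subset_trans (subsetDl _ _) dAB.
have [eB|eB] := boolP (e \in B).
  rewrite (eq_bern_exp _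
      (g := fun x => (1 - p) * ((A \subset x) && (B :\ e \subset ~: x))%:R));
        last first.
    move=> x /=; rewrite setCU1 setCD1 (subU1 A)// (subD1 A)// -subDset.
    by rewrite subsetD1 eB !andbF mulr0 add0r.
  rewrite bern_expZ IHs//.
  - by rewrite (cardsD1 e B) eB exprS mulrCA.
  - apply/subsetP => y; rewrite !inE => yAB; apply: ABs.
      by apply: contraTneq yAB => ->; rewrite eqxx (negbTE eA).
    by case/orP: yAB => [->//|/andP[_ ->]]; rewrite orbT.
  - by apply: subset_trans dAB _; rewrite setCS subsetDl.
rewrite -(IHs A B)//; last first.
  apply/subsetP => y; rewrite !inE => yAB; apply: ABs => //.
  by apply: contraTneq yAB => ->; rewrite negb_or eA eB.
apply: eq_bern_exp => x; rewrite setCU1 setCD1 !subU1// !subD1//.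
ring.
Qed.

Hypothesis p01 : 0 <= p <= 1.

Lemma ler_bern_exp s f g : (forall x, f x <= g x) ->
  bern_exp s f <= bern_exp s g.
Proof.
have /andP[p0 p1] := p01.
elim: s f g => [|e s IHs] f g fg /=; first exact: fg.
apply: IHs => x.
by apply: lerD; apply: ler_wpM2l; rewrite ?subr_ge0.
Qed.

Lemma bern_exp_ge0 s f : (forall x, 0 <= f x) -> 0 <= bern_exp s f.
Proof. by move=> f0; rewrite -(bern_exp_cst s 0); apply: ler_bern_exp. Qed.

(* Efron-Stein inequality for functions with bounded differences. *)
Lemma bern_exp_sqr s f (c : R) : uniq s -> 0 <= c ->
  (forall e x, e \in s -> `|f (e |: x)%SET - f (x :\ e)%SET| <= c) ->
  bern_exp s (fun x => f x ^+ 2)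
  <= bern_exp s f ^+ 2 + (size s)%:R * (p * c ^+ 2).
Proof.
have /andP[p0 p1] := p01 => us c0.
elim: s f us => [|e s IHs] f /=; first by rewrite mul0r addr0.
case/andP=> es us fc.
(* [g] averages [f] over the first coordinate. As a convex combination of values of [f], it inherits
   the bound on differences. *)
pose g x := p * f (e |: x)%SET + (1 - p) * f (x :\ e)%SET.
have gc : bern_exp s (fun x => g x ^+ 2)
  <= bern_exp s g ^+ 2 + (size s)%:R * (p * c ^+ 2).
  apply: IHs => // e' x e's; rewrite /g.
  have ee' : e != e' by apply: contraNneq es => ->.
  have -> : (e |: (e' |: x) = e' |: (e |: x))%SET by rewrite setUCA.
  have -> : (e |: (x :\ e') = (e |: x) :\ e')%SET.
    by apply/setP => y; rewrite !inE; case: eqP => //= ->; rewrite ee'.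
  have -> : ((e' |: x) :\ e = e' |: (x :\ e))%SET.
    by apply/setP => y; rewrite !inE; case: (y =P e) => //= ->;
      rewrite (negbTE ee').
  have -> : (x :\ e' :\ e = x :\ e :\ e')%SET by rewrite !setDDl setUC.
  have e'es : e' \in e :: s by rewrite inE e's orbT.
  have := fc e' (e |: x)%SET e'es; have := fc e' (x :\ e)%SET e'es.
  rewrite !ler_norml; move: (f _) (f _) (f _) (f _) => a b c1 d; nra.
apply: (@le_trans _ _ (bern_exp s (fun x => g x ^+ 2 + p * c ^+ 2))).
  (* With a and b the two values of [f], the average of their squares exceeds [g x ^+ 2] by exactly
     p (1 - p) (a - b)^2. *)
  apply: ler_bern_exp => x; rewrite /g.
  have := fc e x (mem_head _ _); move: (f _) (f _) => a b;
    rewrite ler_norml => ab.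
  have abc : (a - b) ^+ 2 <= c ^+ 2 by nra.
  have : p * (1 - p) * (a - b) ^+ 2 <= p * c ^+ 2 by rewrite -mulrA ler_wpM2l//
    ; nra.
  nra.
rewrite bern_expD bern_exp_cst -natr1 mulrDl mul1r addrA lerD2r.
exact: gc.
Qed.

Lemma bern_exp_markov s f (t : R) : 0 < t -> (forall x, 0 <= f x) ->
  bern_exp s (fun x => (t <= f x)%R%:R) <= bern_exp s f / t.
Proof.
move=> t0 f0; rewrite mulrC -bern_expZ; apply: ler_bern_exp => x.
case: (lerP t) => tf /=; last by rewrite mulr_ge0// invr_ge0 ltW.
by rewrite mulrC ler_pdivlMr// mul1r.
Qed.

(** The mean is only known to be at most [m], hence a one-sided tail. The variance bound is
    [bern_exp_sqr] for [f] minus its mean, a function of mean 0. *)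
Lemma bern_exp_chebyshev s f (c m t : R) : uniq s -> 0 <= c -> 0 < t ->
  (forall e x, e \in s -> `|f (e |: x)%SET - f (x :\ e)%SET| <= c) ->
  bern_exp s f <= m ->
  bern_exp s (fun x => (m + t <= f x)%R%:R)
  <= (size s)%:R * (p * c ^+ 2) / t ^+ 2.
Proof.
move=> us c0 t0 fc fm; set mu := bern_exp s f in fm.
have := @bern_exp_sqr s (fun x => f x - mu) c us c0.
have mu0 : bern_exp s (fun x => f x - mu) = 0.
  by rewrite bern_expD bern_exp_cst subrr.
rewrite mu0 expr0n/= add0r => H.
have {}H : bern_exp s (fun x => (f x - mu) ^+ 2) <= (size s)%:R * (p * c ^+ 2).
  by apply: H => e x es; rewrite opprD opprK addrACA addNr addr0; exact: fc.
have t20 : 0 < t ^+ 2 by rewrite exprn_gt0.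
apply: (@le_trans _ _ (bern_exp s (fun x => (f x - mu) ^+ 2) / t ^+ 2)).
  apply: le_trans (bern_exp_markov s t20 (f := fun x => (f x - mu) ^+ 2) _);
    last first.
    by move=> x; rewrite sqr_ge0.
  apply: ler_bern_exp => x; rewrite ler_nat.
  case: (lerP (m + t)) => // mt; rewrite lt0b.
  by rewrite ler_pXn2r ?nnegrE //; lra.
by rewrite ler_pM2r ?invr_gt0.
Qed.

End BernoulliExpectation.

(** * Trace norm of symmetric matrices *)

Lemma rootsR_prod_XsubC (R : rcfType) (s : seq R) :
  rootsR (\prod_(y <- s) ('X - y%:P)) =i s.
Proof.
move=> x.
have p0 : \prod_(y <- s) ('X - y%:P) != 0.
  by rewrite monic_neq0// monic_prod_XsubC.
have /roots_on_rootsR/(_ x) := p0.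
by rewrite inE/= root_prod_XsubC => <-.
Qed.

(** [rootsR] lists each root once and [mup] restores its multiplicity, so a sum of the shape used in
    [energy] becomes a sum over the list of eigenvalues. *)
Lemma sum_rootsR_prod_XsubC (R : rcfType) (s : seq R) (F : R -> R) :
  let q := \prod_(y <- s) ('X - y%:P) in
  \sum_(x <- rootsR q) F x *+ mup x q = \sum_(y <- s) F y.
Proof.
move=> q; rewrite -[RHS]big_undup_iterop_count (perm_big (undup s)) /=.
  by apply: eq_bigr => x _; rewrite mu_prod_XsubC.
apply: uniq_perm; rewrite ?undup_uniq ?uniq_roots//.
by move=> x; rewrite mem_undup rootsR_prod_XsubC.
Qed.

Lemma char_poly_conj (F : fieldType) n (P A : 'M[F]_n) : P \in unitmx ->
  char_poly (invmx P *m A *m P) = char_poly A.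
Proof.
move=> Pu; pose f (M : 'M[F]_n) := map_mx (@polyC F) M.
have fPP : f (invmx P) *m f P = 1%:M by rewrite -map_mxM mulVmx// map_mx1.
rewrite /char_poly /char_poly_mx !map_mxM/=.
have -> : 'X%:M - f (invmx P) *m f A *m f P
          = f (invmx P) *m ('X%:M - f A) *m f P.
  rewrite mulmxBr mulmxBl; congr (_ - _).
  by rewrite mul_mx_scalar -scalemxAl fPP scalemx1.
by rewrite !det_mulmx mulrC mulrA -det_mulmx (mulmx1C fPP) det1 mul1r.
Qed.

Lemma conjc_conjC (R : rcfType) (z : R[i]) : Num.conj z = conjc z.
Proof. by []. Qed.

(** Over [R[i]] the matrix is Hermitian, so the spectral theorem applies with a real diagonal; the
    factorization of the characteristic polynomial is pulled back along the injection of [R] into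
    [R[i]]. *)
Lemma symmetric_spectral (R : rcfType) n (A : 'M[R]_n) : A^T = A ->
  exists (U : 'M[R[i]]_n) (r : 'rV[R]_n),
  [/\ U \is unitarymx,
      map_mx (real_complex R) A
        = (map_mx Num.conj U^T) *m diag_mx (map_mx (real_complex R) r) *m U
    & char_poly A = \prod_(i < n) ('X - (r 0 i)%:P)].
Proof.
move=> Asym; pose B := map_mx (real_complex R) A.
have Bherm : B \is hermsymmx.
  apply/is_hermitianmxP; rewrite expr0 scale1r; apply/matrixP => i j.
  rewrite !mxE conjc_conjC conjc_real; congr (_%:C)%C.
  by have /matrixP/(_ i j) := Asym; rewrite mxE => <-.
have /orthomx_spectralP := hermitian_normalmx Bherm.
have := hermitian_spectral_diag_real Bherm.
have := spectral_unitarymx B.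
set U := spectralmx B; set D := spectral_diag B => Uu Dr BE.
pose r := map_mx (@complex.Re R) D.
have DE : D = map_mx (real_complex R) r.
  by apply/matrixP => i j; rewrite !mxE RRe_real// (mxOverP Dr).
exists U, r; split => //; first by rewrite -DE -invmx_unitary.
apply: (map_poly_inj (real_complex R)).
rewrite map_char_poly/= -/B BE char_poly_conj ?unitarymx_unit// char_poly_trig;
  last first.
  by apply/is_trig_mxP => i j ij; rewrite mxE -val_eqE (ltn_eqF ij) mulr0n.
rewrite rmorph_prod/=; apply: eq_bigr => i _.
by rewrite DE !mxE eqxx mulr1n rmorphB/= map_polyX map_polyC.
Qed.

Lemma cauchy_schwarz_sum (R : rcfType) (J : finType) (P : pred J)
    (F H : J -> R) :
  (\sum_(i | P i) F i * H i) ^+ 2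
  <= (\sum_(i | P i) F i ^+ 2) * (\sum_(i | P i) H i ^+ 2).
Proof.
set a := \sum_(i | P i) F i ^+ 2; set b := \sum_(i | P i) F i * H i.
set c := \sum_(i | P i) H i ^+ 2.
have a0 : 0 <= a by apply: sumr_ge0 => i _; exact: sqr_ge0.
have c0 : 0 <= c by apply: sumr_ge0 => i _; exact: sqr_ge0.
have key x y : 0 <= x ^+ 2 * a - 2 * x * y * b + y ^+ 2 * c.
  have -> : x ^+ 2 * a - 2 * x * y * b + y ^+ 2 * c
            = \sum_(i | P i) (x * F i - y * H i) ^+ 2.
    rewrite /a /b /c !mulr_sumr -sumrN -!big_split; apply: eq_bigr => i _ /=;
      ring.
  by apply: sumr_ge0 => i _; exact: sqr_ge0.
have := key c b; have [c1|c1] := eqVneq c 0.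
  (* For c = 0, the choice x = b, y = 1 + a gives - (a + 2) b^2 >= 0, hence b = 0. *)
  have := key b (1 + a); rewrite c1; have := sqr_ge0 b => *; nra.
have cp : 0 < c by rewrite lt_def c1.
have -> : c ^+ 2 * a - 2 * c * b * b + b ^+ 2 * c
  = c * (a * c - b ^+ 2) by ring.
by rewrite pmulr_rge0// subr_ge0.
Qed.

(* [X] is the real part of the unitary matrix [sign A]. *)
Lemma spectral_trace_norm (R : rcfType) n (A : 'M[R]_n) : A^T = A ->
  exists X : 'M[R]_n,
  [/\ X^T = X, forall i, \sum_j X i j ^+ 2 <= 1
    & \sum_(x <- rootsR (char_poly A)) `|x| *+ mup x (char_poly A)
      = \sum_i \sum_j X i j * A i j].
Proof.
move=> Asym; have [U [r [Uu AE chiE]]] := symmetric_spectral Asym.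
(* The value at 0 is 1 rather than 0, so that [S] below squares to the identity even when [A] is
   singular. *)
pose sg (x : R) : R := if x < 0 then -1 else 1.
have sgM x : sg x * x = `|x|.
  by rewrite /sg; case: ltrP => x0; rewrite ?mulN1r ?mul1r;
    [rewrite ltr0_norm|rewrite ger0_norm].
have sg2 x : sg x * sg x = 1 by rewrite /sg; case: ifP => _;
  rewrite ?mulrNN mul1r.
pose D := diag_mx (map_mx (real_complex R) (map_mx sg r)).
pose Us : 'M[R[i]]_n := map_mx Num.conj U^T.
have UUs : U *m Us = 1%:M by apply/unitarymxP.
have UsU : Us *m U = 1%:M by apply: mulmx1C.
pose S := Us *m D *m U.
have Ds : map_mx Num.conj D^T = D.
  rewrite tr_diag_mx map_diag_mx; congr diag_mx; apply/matrixP => i j.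
  by rewrite !mxE; exact: conjc_real.
have Sherm : map_mx Num.conj S^T = S.
  rewrite /S !trmx_mul !map_mxM/= Ds /Us map_trmx trmxK -map_mx_comp mulmxA.
  by congr (_ *m _ *m _); apply/matrixP => i j; rewrite !mxE /= conjCK.
have DD : D *m D = 1%:M.
  rewrite mulmx_diag; apply/matrixP => i j; rewrite !mxE -rmorphM sg2 rmorph1.
  by [].
have SS : S *m S = 1%:M.
  by rewrite /S !mulmxA -(mulmxA (Us *m D)) UUs mulmx1 -(mulmxA Us) DD mulmx1.
have trE : \tr (S *m map_mx (real_complex R) A)
  = real_complex R (\sum_i `|r 0 i|).
  rewrite AE -/Us /S mxtrace_mulC !mulmxA -!mulmxA (mulmxA U Us) UUs mul1mx.
  rewrite mxtrace_mulC -!mulmxA UUs mulmx1 mulmx_diag mxtrace_diag rmorph_sum/=.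
  by apply: eq_bigr => i _; rewrite !mxE -sgM -rmorphM mulrC.
clearbody S.
have ReS_sym i j : complex.Re (S i j) = complex.Re (S j i).
  have /matrixP/(_ i j) := Sherm; rewrite !mxE => <-.
  by rewrite conjc_conjC; case: (S j i).
exists (map_mx (@complex.Re R) S); split.
- by apply/matrixP => i j; rewrite !mxE ReS_sym.
(* Since [S] is Hermitian with square 1, the squared moduli of each of its rows sum to 1; dropping
   imaginary parts only lowers the sum. *)
- move=> i; have /matrixP/(_ i i) := SS; rewrite !mxE eqxx mulr1n => Sii.
  have <- : complex.Re (1 : R[i]) = 1 by [].
  rewrite -Sii raddf_sum /=; apply: ler_sum => j _; rewrite mxE.
  have /matrixP/(_ j i) := Sherm; rewrite !mxE conjc_conjC => <-.
  by case: (S i j) => a b /=; rewrite mulrN opprK -!expr2 lerDl sqr_ge0.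
- rewrite chiE -(big_map (fun i => r 0 i) xpredT (fun x => 'X - x%:P)).
  rewrite sum_rootsR_prod_XsubC big_map.
  (* [A] is real, so the real part of the trace only sees the real part of [S]. *)
  have -> : \sum_i `|r 0 i|
    = complex.Re (\tr (S *m map_mx (real_complex R) A)) by rewrite trE.
  rewrite /mxtrace raddf_sum; apply: eq_bigr => i _; rewrite mxE raddf_sum.
  apply: eq_bigr => j _; rewrite !mxE.
  have -> : A j i = A i j by have /matrixP/(_ i j) := Asym; rewrite mxE.
  by case: (S i j) => a b /=; rewrite mulr0 subr0.
Qed.

(** Pairing with a symmetric [X] does not distinguish [B] from its symmetric part [A];
    Cauchy-Schwarz then applies row by row, the rows of [X] having norm at most 1. *)
Lemma trace_norm_le_rows (R : rcfType) n (A B : 'M[R]_n) :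
  A^T = A -> B + B^T = A *+ 2 ->
  \sum_(x <- rootsR (char_poly A)) `|x| *+ mup x (char_poly A)
  <= \sum_i Num.sqrt (\sum_j B i j ^+ 2).
Proof.
move=> Asym BA; have [X [Xsym X1 ->]] := spectral_trace_norm Asym.
have -> : \sum_i \sum_j X i j * A i j = \sum_i \sum_j X i j * B i j.
  apply: (@mulIf _ (2 : R)); first by rewrite pnatr_eq0.
  transitivity (\sum_i \sum_j X i j * (B i j + B j i)).
    rewrite mulr_suml; apply: eq_bigr => i _; rewrite mulr_suml;
      apply: eq_bigr => j _.
    by have /matrixP/(_ i j) := BA; rewrite mulr_natr -mulrnAr !mxE => ->.
  under eq_bigr do (under eq_bigr do rewrite mulrDr);
    under eq_bigr do rewrite big_split.
  rewrite big_split/= mulr_natr mulr2n; congr (_ + _).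
  rewrite exchange_big; apply: eq_bigr => i _; apply: eq_bigr => j _.
  by have /matrixP/(_ i j) := Xsym; rewrite mxE => ->.
apply: ler_sum => i _.
have B0 : 0 <= \sum_j B i j ^+ 2 by apply: sumr_ge0 => j _; exact: sqr_ge0.
apply: le_trans (ler_norm _) _; rewrite -sqrtr_sqr ler_wsqrtr//.
apply: le_trans (cauchy_schwarz_sum _ _ _) _.
by rewrite -[leRHS]mul1r ler_wpM2r.
Qed.

(** * Distribution of the set of occurring events *)

Section Occurring.
Variables (T : Type) (I : finType) (E : I -> set T).

Definition occurring (s : seq I) (w : T) : {set I} :=
  [set e in s | `[< E e w >]]%SET.

(** This lemma and the next one reproduce the two branches of the recursion in [bern_exp]; the
    removal of [e] in the second changes nothing but gives the same form. *)
Lemma occurring_cons_in e s w : E e w ->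
  occurring (e :: s) w = (e |: occurring s w)%SET.
Proof.
move=> Ew; apply/finset.setP => y; rewrite !inE.
by case: (y =P e) => //= ->; apply/asboolP.
Qed.

Lemma occurring_cons_notin e s w : ~ E e w ->
  occurring (e :: s) w = (occurring s w :\ e)%SET.
Proof.
move=> Ew; apply/finset.setP => y; rewrite !inE.
by case: (y =P e) => //= ->; apply/asboolP.
Qed.

End Occurring.

Section Transfer.
Variables (R : realType) (d : measure_display) (T : measurableType d).
Variables (P : probability T R) (I : finType) (D : {set I}) (E : I -> set T).
Variable (p : R).
Hypothesis mE : forall e, e \in D -> measurable (E e).
Hypothesis PE : forall e, e \in D -> P (E e) = p%:E.
Hypothesis indE : mutually_independent P D E.

Let indep (J : {set I}) : set T := \bigcap_(i in [set` J]) E i.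

Let indepU1 e (J : {set I}) : indep (e |: J)%SET = indep J `&` E e.
Proof.
rewrite /indep; apply/seteqP; split => w /=.
  move=> H; split => [i /= iJ|]; apply: H => /=; rewrite !inE ?eqxx//.
  by rewrite iJ orbT.
by move=> [H Ew] i /=; rewrite !inE => /orP[/eqP ->//|]; exact: H.
Qed.

Lemma measurable_indep (J : {set I}) : J \subset D -> measurable (indep J).
Proof.
move=> /fintype.subsetP JD; apply: fin_bigcap_measurable => //.
by move=> i /= iJ; apply/mE/JD.
Qed.

Lemma measurable_occurring s (Q : pred {set I}) : {subset s <= D} ->
  measurable [set w | Q (occurring E s w)].
Proof.
elim: s Q => [|e s IHs] Q sD.
  have -> : [set w | Q (occurring E [::] w)]
    = if Q finset.set0 then setT else set0.
    apply/seteqP; rewrite /mkset; split => w;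
      have -> : occurring E [::] w = finset.set0 by (apply/finset.setP => y;
        rewrite !inE).
      by case: (Q _).
    by case: (Q _).
  by case: ifP.
have sD' : {subset s <= D} by move=> y ys; apply: sD; rewrite inE ys orbT.
have -> : [set w | Q (occurring E (e :: s) w)] =
    (E e `&` [set w | [pred x | Q (e |: x)%SET] (occurring E s w)])
    `|` (~` E e `&` [set w | [pred x | Q (x :\ e)%SET] (occurring E s w)]).
  apply/seteqP; split => w /=.
    have [Ew|Ew] := pselect (E e w).
      by rewrite occurring_cons_in//; left.
    by rewrite occurring_cons_notin//; right.
  by move=> [[Ew]|[Ew]];
    [rewrite occurring_cons_in|rewrite occurring_cons_notin].
have mEe : measurable (E e) by apply/mE/sD/mem_head.
apply: measurableU; apply: measurableI; rewrite ?inE//; try exact: IHs.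
exact: measurableC.
Qed.

(** Independence speaks only of intersections of the events, not of their complements. The induction
    therefore carries a set [J] of events required to occur, and the part where [E e] fails is
    measured as a difference. *)
Lemma prob_indep_occurring s (Q : pred {set I}) (J : {set I}) :
  uniq s -> {subset s <= D} -> J \subset D -> {in J, forall e, e \notin s} ->
  P (indep J `&` [set w | Q (occurring E s w)])
  = (p ^+ #|J| * bern_exp p s (fun x => (Q x)%:R))%:E.
Proof.
elim: s Q J => [|e s IHs] Q J.
  move=> _ _ JD _ /=.
  have -> : [set w | Q (occurring E [::] w)]
    = if Q finset.set0 then setT else set0.
    apply/seteqP; rewrite /mkset; split => w;
      have -> : occurring E [::] w = finset.set0 by (apply/finset.setP => y;
        rewrite !inE).
      by case: (Q _).
    by case: (Q _).
  case: (Q _); rewrite ?setIT ?setI0 ?mulr0 ?mulr1 ?measure0//.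
  rewrite indE// (eq_bigr (fun=> p)) ?prodr_const// => i iJ.
  by rewrite PE// (fintype.subsetP JD).
move=> /= /andP[es us] sD JD Js.
have eD : e \in D by apply: sD; exact: mem_head.
have mEe : measurable (E e) by exact: mE.
have sD' : {subset s <= D} by move=> y ys; apply: sD; rewrite inE ys orbT.
have eJ : e \notin J by apply/negP => /Js; rewrite mem_head.
have Js' : {in J, forall e, e \notin s}.
  by move=> y /Js; rewrite inE negb_or => /andP[].
have eJD : (e |: J)%SET \subset D.
  by apply/fintype.subsetP => y; rewrite !inE => /orP[/eqP->//|];
    exact/fintype.subsetP.
have eJs : {in (e |: J)%SET, forall e, e \notin s}.
  by move=> y; rewrite !inE => /orP[/eqP->//|]; exact: Js'.
pose Q1 : pred {set I} := fun x => Q (e |: x)%SET.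
pose Q0 : pred {set I} := fun x => Q (x :\ e)%SET.
have -> : indep J `&` [set w | Q (occurring E (e :: s) w)] =
    (indep (e |: J)%SET `&` [set w | Q1 (occurring E s w)])
    `|` ((indep J `&` [set w | Q0 (occurring E s w)]) `\` E e).
  rewrite indepU1; apply/seteqP; split => w /=.
    move=> [Jw]; have [Ew|Ew] := pselect (E e w).
      by rewrite occurring_cons_in//; left.
    by rewrite occurring_cons_notin//; right.
  by move=> [[[Jw Ew]]|[[Jw] + Ew]];
    [rewrite occurring_cons_in|rewrite occurring_cons_notin].
have mQ (Q' : pred {set I}) (J' : {set I}) : J' \subset D ->
    measurable (indep J' `&` [set w | Q' (occurring E s w)]).
  by move=> J'D; apply: measurableI;
    [exact: measurable_indep|exact: measurable_occurring].
rewrite measureU; first last.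
- apply/seteqP; split => // w [[+ _] [_ Ew]]; rewrite indepU1; by case.
- by apply: measurableD => //; exact: mQ.
- exact: mQ.
rewrite measureD//; [|exact: mQ|by rewrite ltey_eq fin_num_measure//;
  exact: mQ].
have -> : indep J `&` [set w | Q0 (occurring E s w)] `&` E e =
    indep (e |: J)%SET `&` [set w | Q0 (occurring E s w)].
  by rewrite indepU1 setIAC.
rewrite [in LHS]/= !IHs//= -EFinB -EFinD; congr EFin.
rewrite cardsU1 eJ /= add1n exprS bern_expD !bern_expZ /Q1 /Q0; ring.
Qed.

Lemma prob_occurring (Q : pred {set I}) :
  P [set w | Q (occurring E (enum D) w)]
  = (bern_exp p (enum D) (fun x => (Q x)%:R))%:E.
Proof.
have := @prob_indep_occurring (enum D) Q finset.set0.
rewrite cards0 mul1r enum_uniq finset.sub0set.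
have -> : indep finset.set0 `&` [set w | Q (occurring E (enum D) w)] =
    [set w | Q (occurring E (enum D) w)].
  by apply/seteqP; split => w /=; [case|split => // i; rewrite /= inE].
apply => //; first by move=> y; rewrite mem_enum.
by move=> y; rewrite inE.
Qed.

End Transfer.

(** * Degrees and energy *)

Section Degrees.
Import boot.fintype boot.finset.
Local Open Scope set_scope.
Local Open Scope ring_scope.
Variable n : nat.
Implicit Types (G : sgraph n) (u v : 'I_n) (k : nat).

Definition nbrs G u : {set 'I_n} := [set v | G u v].
Definition deg G u : nat := #|nbrs G u|.
Definition leafdeg G u : nat := #|[set v in nbrs G u | deg G v == 1%N]|.
Definition deg_class G k : {set 'I_n} := [set u | deg G u == k].
(** The pairs are ordered: for [k = 1] an isolated edge counts twice, which is also its energy. *)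
Definition leaf_pairs G k : {set 'I_n * 'I_n} :=
  [set e | [&& G e.1 e.2, deg G e.1 == k & deg G e.2 == 1%N]].

Lemma sum_leafdeg G k :
  (\sum_(u in deg_class G k) leafdeg G u)%N = #|leaf_pairs G k|.
Proof.
rewrite -sum1_card (eq_bigl (fun e : 'I_n * 'I_n => (e.1 \in deg_class G k) &&
   (e.2 \in [set v in nbrs G e.1 | deg G v == 1%N]))); last first.
  by move=> e; rewrite !inE; case: (G _ _); rewrite ?andbF.
rewrite -(pair_big_dep (fun u => u \in deg_class G k)
  (fun u v => v \in [set v in nbrs G u | deg G v == 1%N]) (fun _ _ => 1%N)) /=.
by apply: eq_bigr => u _; rewrite sum1_card.
Qed.

Lemma card_sumr (R : pzSemiRingType) (J : finType) (A : {set J}) :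
  #|A|%:R = \sum_j (j \in A)%:R :> R.
Proof.
rewrite -sum1_card natr_sum big_mkcond; apply: eq_bigr => j _.
by case: (j \in A).
Qed.

(* The leaves whose neighbour is not a leaf: they form an independent set. *)
Definition matched_leaf G u := (deg G u == 1%N) && (leafdeg G u == 0%N).

Lemma leafdeg_gt0 G u v : G u v -> deg G v = 1%N -> (0 < leafdeg G u)%N.
Proof.
by move=> Guv dv; apply/card_gt0P; exists v; rewrite !inE Guv dv eqxx.
Qed.

Lemma leafdeg_le G u : (leafdeg G u <= deg G u)%N.
Proof.
by apply: subset_leq_card; apply/subsetP => v; rewrite inE => /andP[].
Qed.

Lemma energy_le_degrees (R : realType) G : energy R G <=
  #|leaf_pairs G 1|%:R
  + \sum_(u | (1 < deg G u)%N) Num.sqrt ((deg G u)%:R + 3 * (leafdeg G u)%:R).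
Proof.
pose L u := matched_leaf G u.
(* By [LN] below no edge has both ends in [L], so the two entries of an edge add up to 1 + 1 or 2 +
   0. *)
pose B : 'M[R]_n := \matrix_(i, j)
  if G i j && ~~ L i then (if L j then 2 else 1) else 0.
have LN i j : G i j -> L i -> ~~ L j.
  move=> Gij /andP[/eqP di /eqP li]; apply/negP => /andP[/eqP dj _].
  by have := leafdeg_gt0 Gij dj; rewrite li.
have Asym : (adjmx R G)^T = adjmx R G.
  by apply/matrixP => i j; rewrite !mxE adj_sym.
have BA : B + B^T = adjmx R G *+ 2.
  rewrite mulr2n; apply/matrixP => i j; rewrite !mxE (adj_sym G j i).
  have := LN i j; have := LN j i; rewrite (adj_sym G j i).
  case: (G i j) => /=; last by rewrite !addr0.
  case: (L i); case: (L j) => /= H _; [by have := H isT isT| | |]; ring.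
(* A doubled entry has square 4 = 1 + 3, whence the factor 3. *)
have row i : \sum_j B i j ^+ 2 = if L i then 0 else
    (deg G i)%:R + 3 * #|[set j in nbrs G i | L j]|%:R.
  case: ifP => Li.
    by apply: big1 => j _; rewrite mxE Li andbF expr0n.
  rewrite /deg !card_sumr mulr_sumr -big_split; apply: eq_bigr => j _ /=.
  rewrite mxE Li andbT !inE.
  by case: (G i j); case: (L j) => /=; ring.
apply: le_trans (trace_norm_le_rows Asym BA) _.
rewrite -sum_leafdeg natr_sum.
rewrite [X in _ + X]big_mkcond [X in X + _]big_mkcond -big_split /=.
apply: ler_sum => i _; rewrite row !inE.
case: ifP => Li.
  rewrite sqrtr0; apply: addr_ge0; case: ifP => // _; exact: sqrtr_ge0.
have [d0|d1|d1] := ltngtP (deg G i) 1; rewrite ?addr0 ?add0r.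
- have d0' : deg G i = 0%N by case: (deg G i) d0.
  have := leafdeg_le G i.
  have -> : #|[set j in nbrs G i | L j]| = 0%N.
    apply/eqP; rewrite -leqn0 -d0' subset_leq_card//.
    by apply/subsetP => v; rewrite inE => /andP[].
  by rewrite d0' mulr0 addr0 sqrtr0.
- apply: ler_wsqrtr; rewrite lerD2l ler_wpM2l// ler_nat subset_leq_card//.
  by apply/subsetP => v; rewrite !inE => /andP[-> /andP[->]].
(* Here [i] is a leaf outside [L], so it is an end of an isolated edge: its row has norm 1 and its
   [leafdeg] is positive. *)
- have -> : #|[set j in nbrs G i | L j]| = 0%N.
    apply/eqP; rewrite cards_eq0 -subset0; apply/subsetP => v.
    rewrite !inE => /andP[Giv /andP[_ /eqP lv]].
    by have := @leafdeg_gt0 G v i; rewrite adj_sym Giv lv => /(_ isT d1).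
  rewrite d1 mulr0 addr0 sqrtr1 ler1n lt0n.
  by move: Li; rewrite /L /matched_leaf d1 eqxx /= => ->.
Qed.

(** Cauchy-Schwarz against the constant 1 leaves only total counts of the class, which are the
    quantities that concentrate. *)
Lemma sum_deg_class_le (R : realType) G k :
  \sum_(u in deg_class G k) Num.sqrt ((deg G u)%:R + 3 * (leafdeg G u)%:R)
  <= Num.sqrt (#|deg_class G k|%:R
       * (k%:R * #|deg_class G k|%:R + 3 * #|leaf_pairs G k|%:R)) :> R.
Proof.
rewrite -[leLHS]ger0_norm; last by apply: sumr_ge0 => u _; exact: sqrtr_ge0.
rewrite -sqrtr_sqr ler_wsqrtr//.
have := cauchy_schwarz_sum (fun u => u \in deg_class G k) (fun=> 1)
  (fun u => Num.sqrt ((deg G u)%:R + 3 * (leafdeg G u)%:R) : R).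
under eq_bigr do rewrite mul1r.
move=> /le_trans; apply.
under eq_bigr do rewrite expr1n.
rewrite sumr_const ler_wpM2l ?ler0n//.
under eq_bigr do rewrite sqr_sqrtr ?addr_ge0 ?mulr_ge0 ?ler0n//.
rewrite big_split /= -mulr_sumr -!natr_sum sum_leafdeg lerD2r -natrM ler_nat.
rewrite (eq_bigr (fun=> k)); first by rewrite sum_nat_const mulnC.
by move=> u; rewrite inE => /eqP ->.
Qed.

(* The sum of ['C(deg u, 2)] controls the vertices of degree at least [K]. *)
Lemma energy_le_classes (R : realType) G (K : nat) : (1 < K)%N ->
  energy R G <= #|leaf_pairs G 1|%:R
  + \sum_(2 <= k < K) Num.sqrt (#|deg_class G k|%:R
       * (k%:R * #|deg_class G k|%:R + 3 * #|leaf_pairs G k|%:R))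
  + 4 / K.-1%:R * (\sum_u 'C(deg G u, 2))%:R.
Proof.
move=> K1; apply: le_trans (energy_le_degrees R G) _; rewrite -addrA lerD2l.
pose F u : R := Num.sqrt ((deg G u)%:R + 3 * (leafdeg G u)%:R).
have F0 u : 0 <= F u by exact: sqrtr_ge0.
apply: (@le_trans _ _ (\sum_(2 <= k < K) \sum_(u in deg_class G k) F u
   + \sum_u 4 / K.-1%:R * ('C(deg G u, 2))%:R)); last first.
  rewrite natr_sum mulr_sumr lerD2r; apply: ler_sum => k _;
    exact: sum_deg_class_le.
rewrite (exchange_big_dep xpredT)//= -big_split big_mkcond;
  apply: ler_sum => u _ /=.
rewrite (eq_bigl (fun k => k == deg G u)); last by move=> k; rewrite inE eq_sym.
rewrite big_nat1_eq.
have K10 : 0 < K.-1%:R :> R by rewrite ltr0n; case: K K1 => [|[]].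
have c0 : 0 <= 4 / K.-1%:R * ('C(deg G u, 2))%:R :> R.
  by rewrite mulr_ge0 ?divr_ge0 ?ler0n.
case: ifP => d2; last by rewrite addr_ge0//; case: ifP.
case: ltnP => [dK|Kd] /=; first by rewrite lerDl.
rewrite add0r.
have d1 : 1 <= (deg G u)%:R :> R by rewrite ler1n ltnW.
(* For a degree d >= K with l <= d leaf neighbours, sqrt(d + 3 l) <= 2 d, and 2 d is 4 / (d - 1)
   times 'C(d, 2). *)
apply: (@le_trans _ _ (2 * (deg G u)%:R)).
  rewrite -[leRHS]ger0_norm ?mulr_ge0 ?ler0n// -sqrtr_sqr ler_wsqrtr//.
  have : (leafdeg G u)%:R <= (deg G u)%:R :> R by rewrite ler_nat leafdeg_le.
  nra.
rewrite mulrAC ler_pdivlMr//.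
have -> : 4 * ('C(deg G u, 2))%:R = 2 * ((deg G u)%:R * (deg G u).-1%:R) :> R.
  rewrite -[4]/((2 * 2)%:R) -!natrM -mulnA; congr (2 * _)%:R.
  by rewrite mulnC (bin_ffact _ 2) ffactnS ffactn1.
rewrite -mulrA ler_wpM2l// ler_wpM2l// ler_nat.
by case: (deg G u) (K) Kd => [|m] [|k].
Qed.

End Degrees.

(** * Local modifications and expected counts *)

Section Differences.
Import boot.fintype boot.finset.
Local Open Scope set_scope.
Local Open Scope ring_scope.
Variable n : nat.
Implicit Types (G H : sgraph n) (u v a b : 'I_n) (k : nat).

(** By symmetry of adjacency, such graphs differ at most in the edge between [a] and [b]. *)
Definition agree_off a b G H :=
  forall u, u != a -> u != b -> forall v, G u v = H u v.

Lemma agree_off_deg a b G H u : agree_off a b G H -> u != a -> u != b ->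
  deg G u = deg H u.
Proof.
by move=> GH ua ub; rewrite /deg; apply: eq_card => v; rewrite !inE GH.
Qed.

Lemma deg_class_agree_off a b G H k : agree_off a b G H ->
  (#|deg_class G k| <= #|deg_class H k| + 2)%N.
Proof.
move=> GH; apply: (@leq_trans #|deg_class H k :|: [set a; b]|).
  apply/subset_leq_card/subsetP => u; rewrite !inE.
  have [->|ua] := eqVneq u a; first by rewrite orbT.
  have [->|ub] := eqVneq u b; first by rewrite !orbT.
  by rewrite (agree_off_deg GH)// => ->.
apply: leq_trans (leq_card_setU _ _) _; rewrite leq_add2l cards2.
by case: (_ != _).
Qed.

(** Pairs avoiding [a] and [b] survive in [H]. Each of [a] and [b] is the first end of at most [k]
    pairs ([X]) and the leaf end of at most one ([Y]). *)
Lemma leaf_pairs_agree_off a b G H k : agree_off a b G H ->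
  (#|leaf_pairs G k| <= #|leaf_pairs H k| + (2 * k + 2))%N.
Proof.
move=> GH; pose X u : {set 'I_n * 'I_n} := [set e in leaf_pairs G k | e.1 == u].
pose Y v : {set 'I_n * 'I_n} := [set e in leaf_pairs G k | e.2 == v].
have cX u : (#|X u| <= k)%N.
  have [/eqP du|du] := boolP (deg G u == k); last first.
    rewrite (_ : X u = set0) ?cards0//; apply/setP => -[e1 e2]; rewrite !inE /=.
    by case: (e1 =P u) => [->|]; rewrite ?andbF// (negbTE du) !andbF.
  have inj : injective (pair u : 'I_n -> 'I_n * 'I_n) by move=> ? ? [].
  rewrite -[leqRHS]du /deg -(card_imset (nbrs G u) inj).
  apply/subset_leq_card/subsetP => -[e1 e2]; rewrite !inE /=.
  move=> /andP[/and3P[Ge _ _] /eqP e1u]; rewrite -e1u; apply: imset_f.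
  by rewrite inE.
have cY v : (#|Y v| <= 1)%N.
  have [/eqP dv|dv] := boolP (deg G v == 1%N); last first.
    rewrite (_ : Y v = set0) ?cards0//; apply/setP => -[e1 e2]; rewrite !inE /=.
    by case: (e2 =P v) => [->|]; rewrite ?andbF// (negbTE dv) !andbF.
  have inj : injective (pair^~ v : 'I_n -> 'I_n * 'I_n) by move=> ? ? [].
  rewrite -[leqRHS]dv /deg -(card_imset (nbrs G v) inj).
  apply/subset_leq_card/subsetP => -[e1 e2]; rewrite !inE /=.
  move=> /andP[/and3P[Ge _ _] /eqP e2v]; rewrite -e2v;
    apply: (imset_f (pair^~ e2)).
  by rewrite inE adj_sym.
apply: (@leq_trans #|leaf_pairs H k :|: (X a :|: X b :|: (Y a :|: Y b))|).
  apply/subset_leq_card/subsetP => -[u v] Guv; rewrite !inE /=.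
  move: (Guv); rewrite inE /= => GE; rewrite GE.
  have [_|ua] := eqVneq u a; first by rewrite /= !orbT.
  have [_|ub] := eqVneq u b; first by rewrite /= !orbT.
  have [_|va] := eqVneq v a; first by rewrite /= !orbT.
  have [_|vb] := eqVneq v b; first by rewrite /= !orbT.
  by rewrite -GH// -!(agree_off_deg GH)// GE.
apply: leq_trans (leq_card_setU _ _) _; rewrite leq_add2l.
apply: leq_trans (leq_card_setU _ _) _; rewrite mul2n -addnn.
apply: leq_add; apply: leq_trans (leq_card_setU _ _) _.
  by rewrite leq_add.
by rewrite (@leq_add _ _ 1 1).
Qed.

Definition pair_of u v : 'I_n * 'I_n := if (u < v)%N then (u, v) else (v, u).

Lemma pair_ofC u v : pair_of u v = pair_of v u.
Proof. by rewrite /pair_of; case: ltngtP => // /val_inj ->. Qed.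

Lemma pair_of_inj u : injective (pair_of u).
Proof.
move=> v w; rewrite /pair_of.
by do 2!case: ifP => _; case; congruence.
Qed.

Lemma pair_of_eq u v w z : pair_of u v = pair_of w z -> u = w \/ u = z.
Proof.
by rewrite /pair_of; do 2!case: ifP => _; case=> *; subst; auto.
Qed.

Lemma pair_of_vertex_pairs u v : (pair_of u v \in vertex_pairs n) = (u != v).
Proof.
by rewrite inE /pair_of -val_eqE; case: (ltngtP u v) => [||->] //=;
  rewrite ltnn.
Qed.

Section GraphOf.
Variable x : {set 'I_n * 'I_n}.

Let adj_of : rel 'I_n := fun u v => (u != v) && (pair_of u v \in x).

Let adj_of_sym : symmetric adj_of.
Proof. by move=> u v; rewrite /adj_of eq_sym pair_ofC. Qed.

Let adj_of_irr : irreflexive adj_of.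
Proof. by move=> u; rewrite /adj_of eqxx. Qed.

(** Elements of [x] outside [vertex_pairs] have no effect, so every set of pairs yields a graph and
    [bern_exp] can range over arbitrary sets. *)
Definition graph_of := SGraph adj_of_sym adj_of_irr.

Lemma graph_ofE u v : graph_of u v = (u != v) && (pair_of u v \in x).
Proof. by []. Qed.

End GraphOf.

Lemma agree_off_toggle (e : 'I_n * 'I_n) (x : {set 'I_n * 'I_n}) :
  agree_off e.1 e.2 (graph_of (e |: x)) (graph_of (x :\ e)).
Proof.
move=> u u1 u2 v; rewrite !graph_ofE !inE.
suff -> : (pair_of u v == e) = false by [].
apply/negbTE/eqP => ue; move: u1 u2; rewrite -ue /pair_of.
by case: ifP => _ /=; rewrite eqxx.
Qed.

Lemma agree_off_sym a b G H : agree_off a b G H -> agree_off a b H G.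
Proof. by move=> GH u ua ub v; rewrite GH. Qed.

Lemma ler_dist_nat (R : realType) (a b c : nat) :
  (a <= b + c)%N -> (b <= a + c)%N ->
  `|a%:R - b%:R| <= c%:R :> R.
Proof.
rewrite -!(ler_nat R) !natrD => ab ba; rewrite ler_norml; lra.
Qed.

Lemma diff_deg_class (R : realType) k (e : 'I_n * 'I_n)
    (x : {set 'I_n * 'I_n}) :
  `|#|deg_class (graph_of (e |: x)) k|%:R
    - #|deg_class (graph_of (x :\ e)) k|%:R| <= 2%:R :> R.
Proof.
have GH := @agree_off_toggle e x.
by apply: ler_dist_nat; apply: deg_class_agree_off;
  [exact: GH|exact: agree_off_sym GH].
Qed.

Lemma diff_leaf_pairs (R : realType) k (e : 'I_n * 'I_n)
    (x : {set 'I_n * 'I_n}) :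
  `|#|leaf_pairs (graph_of (e |: x)) k|%:R
    - #|leaf_pairs (graph_of (x :\ e)) k|%:R| <= (2 * k + 2)%:R :> R.
Proof.
have GH := @agree_off_toggle e x.
by apply: ler_dist_nat; apply: leaf_pairs_agree_off;
  [exact: GH|exact: agree_off_sym GH].
Qed.

End Differences.

(** * First-moment bounds for the counts *)

Section Expectations.
Import boot.fintype boot.finset.
Local Open Scope set_scope.
Local Open Scope ring_scope.
Variables (R : realType) (n : nat) (p : R).
Hypothesis p01 : 0 <= p <= 1.
Implicit Types (u v : 'I_n) (A B : {set 'I_n}) (x : {set 'I_n * 'I_n}).

Notation Ex := (bern_exp p (enum (vertex_pairs n))).

Definition cylinder (A B : {set 'I_n * 'I_n}) x :=
  (A \subset x) && (B \subset ~: x).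

Lemma Ex_cylinder (A B : {set 'I_n * 'I_n}) : A :|: B \subset vertex_pairs n ->
  A \subset ~: B ->
  Ex (fun x => (cylinder A B x)%:R) = p ^+ #|A| * (1 - p) ^+ #|B|.
Proof.
move=> AB dAB; apply: bern_exp_cylinder => //; first exact: enum_uniq.
by apply: subset_trans AB _; apply/subsetP => y; rewrite mem_enum.
Qed.

(** A union bound over cylinders of equal probability. *)
Lemma Ex_le_cylinders (J : finType) (C : pred J) (A B : J -> {set 'I_n * 'I_n})
    (Q : pred {set 'I_n * 'I_n}) (a b : nat) :
  (forall x, Q x -> exists2 j, C j & cylinder (A j) (B j) x) ->
  (forall j, C j -> [/\ A j :|: B j \subset vertex_pairs n, A j \subset ~: B j,
     #|A j| = a & #|B j| = b]) ->
  Ex (fun x => (Q x)%:R) <= #|C|%:R * (p ^+ a * (1 - p) ^+ b).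
Proof.
move=> QC CAB.
apply: (@le_trans _ _ (Ex (fun x =>
  \sum_(j | C j) (cylinder (A j) (B j) x)%:R))).
  apply: ler_bern_exp => // x; case: (boolP (Q x)) => [/QC[j Cj jx]|_].
    by rewrite (bigD1 j)//= jx lerDl sumr_ge0.
  exact: sumr_ge0.
rewrite bern_exp_sum (eq_bigr (fun=> p ^+ a * (1 - p) ^+ b)).
  by rewrite sumr_const mulr_natl.
by move=> j /CAB[AB dAB <- <-]; exact: Ex_cylinder.
Qed.

Definition star u A : {set 'I_n * 'I_n} := pair_of u @: A.

Lemma card_star u A : #|star u A| = #|A|.
Proof. exact/card_imset/pair_of_inj. Qed.

Lemma star_vertex_pairs u A : u \notin A -> star u A \subset vertex_pairs n.
Proof.
move=> uA; apply/subsetP => _ /imsetP[v vA ->]; rewrite pair_of_vertex_pairs.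
by apply: contraNneq uA => ->.
Qed.

Lemma star_disjoint u A B : A \subset ~: B -> star u A \subset ~: star u B.
Proof.
move=> /subsetP AB; apply/subsetP => _ /imsetP[v vA ->]; rewrite inE.
by rewrite mem_imset; [have := AB v vA; rewrite inE|exact: pair_of_inj].
Qed.

Lemma star_disjoint2 u v A B : u != v -> u \notin B ->
  star u A \subset ~: star v B.
Proof.
move=> uv uB; apply/subsetP => _ /imsetP[w _ ->]; rewrite inE.
apply/imsetP => -[z zB /pair_of_eq[/eqP|uz]]; first by rewrite (negbTE uv).
by rewrite uz zB in uB.
Qed.

Lemma star_nbrs u x :
  star u (nbrs (graph_of x) u) \subset x.
Proof.
by apply/subsetP => _ /imsetP[v + ->]; rewrite inE graph_ofE => /andP[].
Qed.

Lemma star_non_nbrs u x A : A \subset ~: nbrs (graph_of x) u -> u \notin A ->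
  star u A \subset ~: x.
Proof.
move=> /subsetP dA uA; apply/subsetP => _ /imsetP[v vA ->]; rewrite inE.
have := dA v vA; rewrite !inE graph_ofE negb_and negbK.
by case/orP => // /eqP uv; rewrite uv vA in uA.
Qed.

Lemma bin_le_pow m k : 'C(m, k)%:R <= m%:R ^+ k / k`!%:R :> R.
Proof.
rewrite ler_pdivlMr ?ltr0n ?fact_gt0// -natrM -natrX ler_nat bin_ffact.
elim: k => [//|k IHk]; rewrite ffactnSr expnSr; exact: leq_mul (leq_subr _ _).
Qed.

Lemma card_draws_le k : #|[set A : {set 'I_n} | #|A| == k]|%:R
  <= n%:R ^+ k / k`!%:R :> R.
Proof. by rewrite card_draws card_ord bin_le_pow. Qed.

(** For each [u], the cylinders are indexed by the possible neighbourhoods [A] of size [k]: the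
    pairs from [u] to [A] are present and the other n - 1 - k pairs at [u] absent. *)
Lemma Ex_deg_class k :
  Ex (fun x => #|deg_class (graph_of x) k|%:R)
  <= n%:R * ((n%:R * p) ^+ k / k`!%:R * (1 - p) ^+ (n - 1 - k)).
Proof.
have /andP[p0 p1] := p01.
rewrite (eq_bern_exp _ _ (fun x => card_sumr R (deg_class (graph_of x) k))).
rewrite bern_exp_sum.
apply: (@le_trans _ _ (\sum_(u < n) ((n%:R * p) ^+ k / k`!%:R * (1 - p) ^+ (n -
  1 - k)))).
  apply: ler_sum => u _.
  pose C := [set A : {set 'I_n} | (#|A| == k) && (u \notin A)].
  apply: le_trans (@Ex_le_cylinders _ (mem C) (star u) (fun A =>
    star u (~: (u |: A)))
     (fun x => u \in deg_class (graph_of x) k) k (n - 1 - k) _ _) _.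
  - move=> x; rewrite inE => du; exists (nbrs (graph_of x) u).
      by rewrite !inE du graph_ofE eqxx.
    rewrite /cylinder star_nbrs star_non_nbrs// ?inE ?eqxx//.
    by rewrite setCS subsetUr.
  - move=> A; rewrite !inE => /andP[/eqP Ak uA]; split.
    + by rewrite subUset !star_vertex_pairs// !inE eqxx.
    + by rewrite star_disjoint// setCK subsetUr.
    + by rewrite card_star.
    + rewrite card_star cardsCs setCK card_ord cardsU1 uA Ak; lia.
  rewrite mulrA ler_wpM2r ?exprn_ge0 ?subr_ge0//.
  rewrite exprMn mulrAC ler_wpM2r ?exprn_ge0//.
  apply: le_trans _ (card_draws_le k); rewrite ler_nat.
  by apply/subset_leq_card/subsetP => A; rewrite !inE => /andP[].
by rewrite sumr_const card_ord -[leLHS]mulr_natl.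
Qed.

(** For u != v, the neighbourhood [A] of [u] contains [v]; besides the n - 1 - k pairs at [u], the n
    - 2 pairs from [v] to the remaining vertices are absent. Deleting [v] from [A] leaves at most
    'C(n, k - 1) choices. *)
Lemma Ex_leaf_pairs k : (0 < k)%N ->
  Ex (fun x => #|leaf_pairs (graph_of x) k|%:R)
  <= n%:R * ((n%:R * p) ^+ k / k.-1`!%:R * (1 - p) ^+ (n - 1 - k + (n - 2))).
Proof.
have /andP[p0 p1] := p01; move=> k0.
rewrite (eq_bern_exp _ _ (fun x => card_sumr R (leaf_pairs (graph_of x) k))).
rewrite bern_exp_sum.
have q0 : 0 <= (1 - p) ^+ (n - 1 - k + (n - 2)) by rewrite exprn_ge0 ?subr_ge0.
apply: (@le_trans _ _ (\sum_(e : 'I_n * 'I_n)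
    (n%:R ^+ k.-1 / k.-1`!%:R * (p ^+ k * (1 - p) ^+ (n - 1 - k + (n - 2)))))).
  apply: ler_sum => -[u v] _.
  have [uv|uv] := eqVneq u v.
    rewrite (eq_bern_exp _ _ (g := fun=> 0)) ?bern_exp_cst.
      by rewrite !mulr_ge0 ?exprn_ge0 ?invr_ge0 ?subr_ge0.
    by move=> x; rewrite !inE uv graph_ofE eqxx.
  pose C := [set A : {set 'I_n} | [&& #|A| == k, u \notin A & v \in A]].
  apply: le_trans (@Ex_le_cylinders _ (mem C) (star u)
     (fun A => star u (~: (u |: A)) :|: star v (~: [set u; v]))
     (fun x => (u, v) \in leaf_pairs (graph_of x) k) k (n - 1 - k
       + (n - 2)) _ _) _.
  - move=> x; rewrite inE => /and3P[Guv du /eqP dv];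
    exists (nbrs (graph_of x) u).
      by rewrite !inE du Guv graph_ofE eqxx.
    rewrite /cylinder star_nbrs subUset !star_non_nbrs// ?inE ?eqxx ?orbT//;
      last first.
      by rewrite setCS subsetUr.
    rewrite setCS; apply/subsetP => w vw.
    move/eqP/cards1P: dv => [z Ez].
    have := vw; rewrite Ez inE => /eqP ->.
    have : u \in nbrs (graph_of x) v by rewrite inE adj_sym.
    by rewrite Ez !inE => /eqP ->; rewrite eqxx.
  - move=> A; rewrite !inE => /and3P[/eqP Ak uA vA].
    have uU : u \notin ~: (u |: A) by rewrite !inE eqxx.
    have vU : v \notin ~: [set u; v] by rewrite !inE eqxx orbT.
    have uV : u \notin ~: [set u; v] by rewrite !inE eqxx.
    split.
    + by rewrite !subUset !star_vertex_pairs.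
    + by rewrite [~: (star _ _ :|: _)]setCU subsetI star_disjoint
      ?star_disjoint2 ?setCK ?subsetUr.
    + by rewrite card_star.
    + rewrite cardsU (_ : _ :&: _ = set0) ?cards0 ?subn0; last first.
        by apply/eqP; rewrite setI_eq0 disjoints_subset star_disjoint2.
      rewrite !card_star [#|~: (_ |: _)|]cardsCs [#|~: [set _;
        _]|]cardsCs !setCK.
      rewrite !card_ord cardsU1 uA Ak cards2 uv; lia.
  rewrite ler_wpM2r ?mulr_ge0 ?exprn_ge0 ?subr_ge0//.
  apply: le_trans _ (card_draws_le k.-1); rewrite ler_nat.
  have inj : {in C &, injective (fun A => A :\ v)}.
    move=> A B; rewrite !inE => /and3P[_ _ vA] /and3P[_ _ vB] AB.
    by rewrite -(setD1K vA) AB setD1K.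
  rewrite -(card_in_imset inj).
  apply/subset_leq_card/subsetP => _ /imsetP[A + ->].
  rewrite !inE => /and3P[/eqP Ak _ vA]; rewrite -Ak (cardsD1 v A) vA.
  by [].
rewrite sumr_const card_prod !card_ord -[leLHS]mulr_natl natrM le_eqVlt;
  apply/orP; left.
by case: k k0 {q0} => // k _; rewrite exprMn !exprS; apply/eqP; ring.
Qed.

(** The binomial counts two-element sets of neighbours of [u]; each such set occurs with probability
    [p ^+ 2], and there are at most n^2 of them. *)
Lemma Ex_pairs_of_nbrs :
  Ex (fun x => (\sum_u 'C(deg (graph_of x) u, 2))%:R)
  <= n%:R * (n%:R * p) ^+ 2.
Proof.
have /andP[p0 p1] := p01.
rewrite (eq_bern_exp _ _ (g := fun x => \sum_u \sum_(A : {set 'I_n} | #|A| == 2)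
   (A \subset nbrs (graph_of x) u)%:R)); last first.
  move=> x; rewrite natr_sum; apply: eq_bigr => u _.
  rewrite -cards_draws card_sumr [RHS]big_mkcond; apply: eq_bigr => A _.
  by rewrite inE andbC; case: ifP.
rewrite bern_exp_sum.
apply: (@le_trans _ _ (\sum_(u < n) ((n%:R * p) ^+ 2))); last first.
  by rewrite sumr_const card_ord -[leLHS]mulr_natl.
apply: ler_sum => u _; rewrite bern_exp_sum.
apply: (@le_trans _ _ (\sum_(A : {set 'I_n} | #|A| == 2) p ^+ 2)).
  apply: ler_sum => A /eqP A2; have [uA|uA] := boolP (u \in A).
    rewrite (eq_bern_exp _ _ (g := fun=> 0)) ?bern_exp_cst ?exprn_ge0// => x.
    rewrite (_ : (A \subset _) = false)//; apply/negbTE/subsetPn.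
    by exists u => //; rewrite inE graph_ofE eqxx.
  apply: (@le_trans _ _ (Ex (fun x => (cylinder (star u A) set0 x)%:R))).
    apply: ler_bern_exp => // x; rewrite ler_nat /cylinder sub0set andbT.
    case: (boolP (A \subset _)) => // AN; rewrite lt0b.
    exact: subset_trans (imsetS _ AN) (star_nbrs _ _).
  rewrite Ex_cylinder ?setU0 ?star_vertex_pairs ?setC0 ?subsetT//.
  by rewrite card_star A2 cards0 mulr1.
rewrite sumr_const -[_ *+ _]mulr_natl exprMn ler_wpM2r ?exprn_ge0//.
rewrite -cardsE; apply: le_trans (card_draws_le 2) _.
by rewrite ler_pdivrMr// ler_peMr ?exprn_ge0// (ler_nat _ 1 2).
Qed.

End Expectations.

(** * Concentration and limits *)

(** The real [c] may be negative, which absorbs truncated subtraction in the exponent [m]. *)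
Lemma pow1B_le_expR (R : realType) (p c : R) m : 0 <= p <= 1 -> c <= m%:R ->
  (1 - p) ^+ m <= expR (- (p * c)).
Proof.
move=> /andP[p0 p1] cm; apply: (@le_trans _ _ (expR (- p) ^+ m)).
  by rewrite lerXn2r ?nnegrE ?subr_ge0 ?expR_ge0// expR_ge1Dx.
by rewrite -expRM_natl ler_expR mulrN lerN2 [m%:R * p]mulrC ler_wpM2l.
Qed.

Lemma cvg_sumr (R : realType) (T : Type) (F : set_system T) (FF : Filter F)
    (I : Type) (r : seq I) (P : pred I) (f : I -> T -> R) (a : I -> R) :
  (forall i, P i -> f i x @[x --> F] --> a i) ->
  \sum_(i <- r | P i) f i x @[x --> F] --> \sum_(i <- r | P i) a i.
Proof. by move=> fa; apply: cvg_big => //; exact: add_continuous. Qed.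

Section Sparse.
Variables (R : realType) (lambda : R) (p : nat -> R).
Hypothesis p01 : forall n : nat, (0 < n)%N -> 0 <= p n <= 1.
Hypothesis np_lambda : (fun n : nat => n%:R * p n) @ \oo --> lambda.

Notation Ex n := (bern_exp (p n) (enum (vertex_pairs n))).

Lemma edge_prob_cvg0 : p @ \oo --> 0.
Proof.
have H : (fun n => (n.+1%:R * p n.+1) * harmonic n) @ \oo --> lambda * 0.
  apply: cvgM; last exact: cvg_harmonic.
  by have := np_lambda; rewrite -cvg_shiftS.
rewrite mulr0 in H; rewrite -cvg_shiftS; apply: cvg_trans H.
apply: near_eq_cvg; near=> n.
by rewrite /= mulrAC mulfV ?mul1r// pnatr_eq0.
Unshelve. all: by end_near. Qed.

Lemma size_vertex_pairs n : (size (enum (vertex_pairs n)) <= n * n)%N.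
Proof.
rewrite -cardE; apply: leq_trans (max_card _) _.
by rewrite card_prod card_ord.
Qed.

(* Chebyshev: the variance is [O(n ^ 2 * p n) = o(n ^ 2)]. *)
Lemma bounded_diff_whp (f : forall n, {set 'I_n * 'I_n} -> R) (g : nat -> R)
    (a c delta : R) : 0 <= c -> 0 < delta ->
  (forall n e (x : {set 'I_n * 'I_n}),
    `|f n (e |: x)%SET - f n (x :\ e)%SET| <= c) ->
  (forall n, (0 < n)%N -> Ex n (f n) <= n%:R * g n) ->
  g @ \oo --> a ->
  (fun n => Ex n (fun x => (n%:R * (a + delta) <= f n x)%R%:R)) @ \oo --> 0.
Proof.
move=> c0 d0 fc fg ga.
have d2 : 0 < delta / 2 by rewrite divr_gt0.
apply: (@squeeze_cvgr _ _ _ _ (fun=> 0) (fun n =>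
  p n * (c ^+ 2 / (delta / 2) ^+ 2))).
- near=> n.
  have n0 : (0 < n)%N by near: n; exact: nbhs_infty_gt.
  have p01n := p01 n0; have /andP[p0 _] := p01n.
  have nR0 : 0 < n%:R :> R by rewrite ltr0n.
  rewrite bern_exp_ge0//=.
  (* Half of [delta] covers the distance of the mean from its limit, the other half the deviation in
     Chebyshev's inequality. *)
  have gn : g n <= a + delta / 2.
    by near: n; apply: (cvgr_le _ ga); rewrite ltrDl.
  have := @bern_exp_chebyshev R _ (p n) p01n (enum (vertex_pairs n)) (f n) c
    (n%:R * (a + delta / 2)) (n%:R * (delta / 2)) (enum_uniq _) c0.
  rewrite -mulrDr -addrA -splitr => H.
  apply: le_trans (H _ _ _) _; first by rewrite mulr_gt0.
  + by move=> e x _; exact: fc.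
  + by apply: le_trans (fg n n0) _; rewrite ler_pM2l.
  rewrite exprMn ler_pdivrMr ?mulr_gt0 ?exprn_gt0//.
  have -> : p n * (c ^+ 2 / (delta / 2) ^+ 2) * (n%:R ^+ 2 * (delta / 2) ^+ 2)
     = (n * n)%:R * (p n * c ^+ 2) by rewrite natrM; field; lra.
  by rewrite ler_wpM2r ?mulr_ge0 ?exprn_ge0// ler_nat size_vertex_pairs.
- exact: cvg_cst.
- rewrite -[X in _ --> X](mul0r (c ^+ 2 / (delta / 2) ^+ 2)).
  by apply: cvgM; [exact: edge_prob_cvg0|exact: cvg_cst].
Unshelve. all: by end_near. Qed.

(** Common form of the two mean bounds, with [m] equal to 1 or 2; the term [p n * c] collects the
    bounded shift of the exponent and vanishes in the limit. *)
Lemma cvg_poisson_mass k (c : R) (m : R) (b : nat):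
  (fun n => (n%:R * p n) ^+ k / b%:R * expR (- (m * (n%:R * p n))
    + p n * c)) @ \oo
  --> lambda ^+ k / b%:R * expR (- (m * lambda)).
Proof.
apply: cvgM.
  apply: cvgM; last exact: cvg_cst.
  by apply: (continuous_cvg _ (@exprn_continuous R k lambda)).
rewrite -[X in expR X]addr0 -[X in _ + X](mul0r c).
apply: (continuous_cvg _ (@continuous_expR R _)).
apply: cvgD; last by apply: cvgM; [exact: edge_prob_cvg0|exact: cvg_cst].
by apply: cvgN; apply: cvgM; [exact: cvg_cst|].
Qed.

Definition deg_limit k : R := lambda ^+ k / k`!%:R * expR (- lambda).
(** For [k > 0] this is lambda times the Poisson masses at k - 1 and at 0: the two ends of an edge
    have k - 1 and no further neighbours. *)
Definition leaf_limit k : R := lambda ^+ k / k.-1`!%:R * expR (- (2 * lambda)).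

Lemma deg_class_whp k delta : 0 < delta ->
  (fun n => Ex n (fun x => (n%:R * (deg_limit k + delta)
     <= #|deg_class (graph_of x) k|%:R :> R)%R%:R)) @ \oo --> 0.
Proof.
move=> d0; have := @cvg_poisson_mass k k.+1%:R 1 k`!; rewrite mul1r => lim.
apply: (bounded_diff_whp (f := fun n x => #|deg_class (graph_of x) k|%:R)
  _ d0 _ _ lim) => [|n e x|n n0]; [exact: (ler0n R 2)|exact: diff_deg_class|].
apply: le_trans (Ex_deg_class n (p01 n0) k) _.
have /andP[p0 p1] := p01 n0.
rewrite ler_wpM2l// ler_wpM2l ?divr_ge0 ?exprn_ge0 ?mulr_ge0//.
(* The exponent n - 1 - k is truncated at 0, so it is at least the real number n - (k + 1) for every
   n. *)
have -> : - (1 * (n%:R * p n)) + p n * k.+1%:R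
  = - (p n * (n%:R - k.+1%:R)) by ring.
apply: pow1B_le_expR (p01 n0) _.
by rewrite lerBlDr -natrD ler_nat; lia.
Qed.

Lemma leaf_pairs_whp k delta : (0 < k)%N -> 0 < delta ->
  (fun n => Ex n (fun x => (n%:R * (leaf_limit k + delta)
     <= #|leaf_pairs (graph_of x) k|%:R :> R)%R%:R)) @ \oo --> 0.
Proof.
move=> k0 d0; have lim := @cvg_poisson_mass k (k + 3)%:R 2 k.-1`!.
apply: (bounded_diff_whp (f := fun n x => #|leaf_pairs (graph_of x) k|%:R)
  _ d0 _ _ lim) => [|n e x|n n0];
  [exact: (ler0n R (2 * k + 2))|exact: diff_leaf_pairs|].
apply: le_trans (Ex_leaf_pairs n (p01 n0) k0) _.
have /andP[p0 p1] := p01 n0.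
rewrite ler_wpM2l// ler_wpM2l ?divr_ge0 ?exprn_ge0 ?mulr_ge0//.
have -> : - (2 * (n%:R * p n)) + p n * (k + 3)%:R
  = - (p n * ((2 * n)%:R - (k + 3)%:R)) by rewrite !natrM; ring.
apply: pow1B_le_expR (p01 n0) _.
by rewrite lerBlDr -natrD ler_nat; lia.
Qed.

(** Toggling an edge changes this sum by an amount that is not bounded in n, so Markov's inequality
    replaces Chebyshev's, and [tau] must be large to make the probability small. *)
Lemma pairs_of_nbrs_whp tau eta : 0 < tau -> lambda ^+ 2 / tau < eta ->
  \forall n \near \oo, Ex n (fun x => (n%:R * tau
     <= (\sum_u 'C(deg (graph_of x) u, 2))%:R :> R)%R%:R) <= eta.
Proof.
move=> tau0 teta; near=> n.
have n0 : (0 < n)%N by near: n; exact: nbhs_infty_gt.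
have nR0 : 0 < n%:R :> R by rewrite ltr0n.
have p01n := p01 n0.
apply: (@le_trans _ _ ((n%:R * p n) ^+ 2 / tau)); last first.
  near: n; apply: cvgr_le teta.
  apply: cvgM; last exact: cvg_cst.
  by apply: (continuous_cvg _ (@exprn_continuous R 2 lambda)).
apply: le_trans (bern_exp_markov p01n _ _ _) _; first by rewrite mulr_gt0.
  by move=> x; exact: ler0n.
rewrite ler_pdivrMr ?mulr_gt0//.
apply: le_trans (Ex_pairs_of_nbrs n p01n) _.
by rewrite [leRHS]mulrCA divfK ?gt_eqF.
Unshelve. all: by end_near. Qed.

(** The bound of [energy_le_classes] is monotone and homogeneous of degree 1 in the counts, so the
    factor n comes out. *)
Lemma energy_le_of_counts n (G : sgraph n) (K : nat) (A B : nat -> R)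
    (tau : R) :
  (1 < K)%N ->
  (forall k, (0 < k < K)%N -> #|deg_class G k|%:R <= n%:R * A k) ->
  (forall k, (0 < k < K)%N -> #|leaf_pairs G k|%:R <= n%:R * B k) ->
  (\sum_u 'C(deg G u, 2))%:R <= n%:R * tau ->
  energy R G <= n%:R * (B 1%N
    + \sum_(2 <= k < K) Num.sqrt (A k * (k%:R * A k + 3 * B k))
    + 4 / K.-1%:R * tau).
Proof.
move=> K1 hA hB ht; apply: le_trans (energy_le_classes R G K1) _.
rewrite !mulrDr; apply: lerD; first (apply: lerD; first by rewrite hB).
  rewrite mulr_sumr big_nat [leRHS]big_nat; apply: ler_sum => k /andP[k2 kK].
  have k1 : (0 < k < K)%N by rewrite kK (ltn_trans _ k2).
  have {}hA := hA k k1; have {}hB := hB k k1.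
  rewrite -[n%:R in leRHS]ger0_norm ?ler0n// -sqrtr_sqr -sqrtrM ?sqr_ge0//.
  apply: ler_wsqrtr.
  have -> : n%:R ^+ 2 * (A k * (k%:R * A k + 3 * B k)) =
    (n%:R * A k) * (k%:R * (n%:R * A k) + 3 * (n%:R * B k)) by ring.
  apply: ler_pM; [exact: ler0n|by rewrite addr_ge0 ?mulr_ge0 ?ler0n|exact: hA|].
  by apply: lerD; rewrite ler_wpM2l.
by rewrite [leRHS]mulrCA ler_wpM2l// divr_ge0.
Qed.

End Sparse.

(** * Comparison of the limiting constants with the energy bound *)

Section Limits.
Variables (R : realType) (lambda : R).
Hypothesis lambda_gt0 : 0 < lambda.

Let term k : R := lambda ^+ k * Num.sqrt k%:R / k`!%:R.

Let term_ge0 k : 0 <= term k.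
Proof. by rewrite divr_ge0// mulr_ge0 ?sqrtr_ge0// exprn_ge0// ltW. Qed.

Lemma sum_term_le_lim K : \sum_(2 <= k < K) term k
  <= limn (fun N : nat => \sum_(2 <= k < N) term k).
Proof.
have homo : {homo (fun N : nat => \sum_(2 <= k < N) term k) : n m / (n
  <= m)%N >-> n <= m}.
  apply: (homo_leq (@lexx _ _) (@le_trans _ _)) => N.
  have [N2|N2] := leqP 2 N; first by rewrite big_nat_recr//= lerDl.
  by rewrite !big_geq// ltnW.
apply: nondecreasing_cvgn_le => //; apply: nondecreasing_is_cvgn => //.
(* Since sqrt k <= 2^k, the series is dominated by the exponential series at [2 * lambda]; this
   bound makes the [limn] a genuine limit. *)
exists (expR (2 * lambda)) => _ [N _ <-].
apply: (@le_trans _ _ (series (exp_coeff (2 * lambda)) N)); last first.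
  apply: (nondecreasing_cvgn_le _ (is_cvg_series_exp_coeff _)).
  apply: nondecreasing_series => k _; rewrite /exp_coeff /=.
  by rewrite divr_ge0// exprn_ge0// mulr_ge0// ltW.
rewrite big_geq_mkord seriesEord/= big_mkcond; apply: ler_sum => k _ /=.
have le_term : term k <= (2 * lambda) ^+ k / k`!%:R.
  rewrite ler_wpM2r// exprMn mulrC ler_wpM2r ?exprn_ge0 ?(ltW lambda_gt0)//.
  rewrite -[leRHS]ger0_norm ?exprn_ge0// -sqrtr_sqr ler_wsqrtr//.
  rewrite -!natrX ler_nat (leq_trans (ltnW (ltn_expl k (ltnSn 1))))//.
  by rewrite -expnM leq_pexp2l// leq_pmulr.
case: ifP => // _; apply: le_trans le_term; exact: term_ge0.
Qed.

(** The summand for each [k] equals the corresponding term of the series: 1 / (k - 1)! = k / k!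
    turns the radicand into a square times k (3 e^-lambda + 1). *)
Lemma limits_le_energy_bound K :
  leaf_limit lambda 1 + \sum_(2 <= k < K) Num.sqrt (deg_limit lambda k
    * (k%:R * deg_limit lambda k + 3 * leaf_limit lambda k))
  <= energy_bound lambda.
Proof.
rewrite /energy_bound; apply: lerD.
  (* The leaf term is lambda e^(-2 lambda), half of the first term of the bound. *)
  rewrite /leaf_limit fact0 divr1 expr1 -mulrA ler_peMl//.
    by rewrite mulr_ge0 ?expR_ge0 ?ltW.
  by rewrite (ler_nat _ 1 2).
have c0 : 0 <= expR (- lambda) * Num.sqrt (3 * expR (- lambda) + 1).
  by rewrite mulr_ge0 ?expR_ge0 ?sqrtr_ge0.
apply: le_trans (ler_wpM2l c0 (sum_term_le_lim K)).
rewrite mulr_sumr big_nat [leRHS]big_nat; apply: ler_sum => k /andP[k2 _].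
have e0 := expR_ge0 (- lambda).
rewrite /leaf_limit /deg_limit /term.
have -> : expR (- (2 * lambda)) = expR (- lambda) ^+ 2.
  by rewrite -mulrN expRM_natl.
have -> : (k.-1`!%:R)^-1 = k%:R / k`!%:R :> R.
  case: k k2 => // k _; rewrite factS natrM invfM mulrA mulfV ?mul1r//.
move: (expR (- lambda)) e0 => e e0.
have -> : lambda ^+ k / k`!%:R * e *
     (k%:R * (lambda ^+ k / k`!%:R * e)
       + 3 * (lambda ^+ k * (k%:R / k`!%:R) * e ^+ 2))
   = (lambda ^+ k / k`!%:R * e) ^+ 2 * k%:R * (3 * e + 1) by ring.
rewrite sqrtrM; last by apply: mulr_ge0; [exact: sqr_ge0|exact: ler0n].
rewrite sqrtrM ?sqr_ge0// sqrtr_sqr ger0_norm; last first.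
  by rewrite mulr_ge0// divr_ge0// exprn_ge0// ltW.
by rewrite le_eqVlt; apply/orP; left; apply/eqP; ring.
Qed.

(** The left side is continuous in [delta] from the right at 0, where [limits_le_energy_bound]
    applies. *)
Lemma exists_margin K (eps : R) : 0 < eps -> exists2 delta : R, 0 < delta &
  leaf_limit lambda 1 + delta
  + \sum_(2 <= k < K) Num.sqrt ((deg_limit lambda k + delta)
    * (k%:R * (deg_limit lambda k + delta) + 3 * (leaf_limit lambda k + delta)))
  <= energy_bound lambda + eps.
Proof.
move=> eps0.
have shift (a : R) : (fun t : R => a + t) @ (0^'+) --> a.
  rewrite -[X in _ --> X]addr0; apply: cvgD; first exact: cvg_cst.
  exact/cvg_at_right_filter/cvg_id.
have : (fun t => leaf_limit lambda 1 + t
  + \sum_(2 <= k < K) Num.sqrt ((deg_limit lambda k + t)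
    * (k%:R * (deg_limit lambda k + t) + 3 * (leaf_limit lambda k + t))))
   @ (0^'+) --> leaf_limit lambda 1 + \sum_(2
     <= k < K) Num.sqrt (deg_limit lambda k
    * (k%:R * deg_limit lambda k + 3 * leaf_limit lambda k)).
  apply: cvgD; first exact: shift.
  apply: cvg_sumr => k _; apply: (continuous_cvg _ (@sqrt_continuous R _)).
  apply: cvgM; first exact: shift.
  by apply: cvgD; apply: cvgM;
    [exact: cvg_cst|exact: shift|exact: cvg_cst|exact: shift].
move=> /cvgr_le/(_ (energy_bound lambda + eps)) H.
have {}H := H (le_lt_trans (limits_le_energy_bound K) _).
near ((0:R)^'+) => t.
exists t; first by near: t; exact: nbhs_right_gt.
by near: t; apply: H; rewrite ltrDl.
Unshelve. all: by end_near. Qed.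

End Limits.

(** * Union bound and transfer to the random graph *)

Lemma energy_eq_adj (R : realType) n (G H : sgraph n) : G =2 H ->
  energy R G = energy R H.
Proof.
move=> GH; rewrite /energy (_ : adjmx R G = adjmx R H)//.
by apply/matrixP => i j; rewrite !mxE GH.
Qed.

Lemma graph_of_occurring (T : Type) n (G : T -> sgraph n) (w : T) :
  G w =2 graph_of (occurring (edge_event G) (enum (vertex_pairs n)) w).
Proof.
move=> u v; rewrite graph_ofE inE mem_enum pair_of_vertex_pairs.
have [->|uv] := eqVneq u v; first by rewrite adj_irr.
rewrite /= /pair_of /edge_event.
by case: ifP => _ /=; rewrite ?(adj_sym (G w) v u);
  apply/idP/asboolP.
Qed.

Lemma prob_graph_property (R : realType) (d : measure_display)
    (T : measurableType d) (P : probability T R) n (p : R) (G : T -> sgraph n)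
    (Q : pred {set 'I_n * 'I_n}) : is_Gnp P p G ->
  P [set w | Q (occurring (edge_event G) (enum (vertex_pairs n)) w)]
  = (bern_exp p (enum (vertex_pairs n)) (fun x => (Q x)%:R))%:E.
Proof. by case=> mE PE indE; exact: prob_occurring. Qed.

(** Given [eta], the cutoff [tau] is chosen first, then [K], then [delta]. Half of [eps] pays for
    the degrees at least [K] and half for [delta]; half of [eta] pays for the count deviations and
    half for the Markov bound. *)
Lemma energy_graph_of_whp (R : realType) (lambda : R) (lambda_gt0 : 0 < lambda)
    (p : nat -> R)
    (p01 : forall n : nat, (0 < n)%N -> 0 <= p n <= 1)
    (np_lambda : (fun n : nat => n%:R * p n) @ \oo --> lambda)
    (eps : R) (eps_gt0 : 0 < eps) :
  (fun n => bern_exp (p n) (enum (vertex_pairs n))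
     (fun x => (energy R (graph_of x) / n%:R <= energy_bound lambda
       + eps)%R%:R))
  @ \oo --> (1 : R).
Proof.
apply/cvgrPdist_le => eta eta0.
(* The added 1 makes the inequality [lam_tau] strict. *)
pose tau := (lambda ^+ 2 + 1) / (eta / 2).
have tau0 : 0 < tau by rewrite !divr_gt0// ltr_wpDl ?sqr_ge0.
have lam_tau : lambda ^+ 2 / tau < eta / 2.
  rewrite /tau invf_div mulrCA gtr_pMr ?divr_gt0// ltr_pdivrMr ?mul1r ?ltrDl//.
  by rewrite ltr_wpDl ?sqr_ge0.
have [K K1 Ktau] : exists2 K, (1 < K)%N & 4 / K.-1%:R * tau <= eps / 2.
  (* Here m = K - 1, and m >= 8 tau / eps gives 4 tau / m <= eps / 2. *)
  pose m := (Num.truncn (8 * tau / eps)).+1.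
  exists m.+1 => //=; rewrite mulrAC ler_pdivrMr ?ltr0n//.
  have : 8 * tau / eps <= m%:R by rewrite ltW// truncnS_gt.
  rewrite ler_pdivrMr//; lra.
have [delta d0 hdelta] := exists_margin lambda_gt0 K
  (divr_gt0 eps_gt0 (ltr0Sn R 1)).
pose A k := deg_limit lambda k + delta.
pose B k := leaf_limit lambda k + delta.
pose Ex n := bern_exp (p n) (enum (vertex_pairs n)).
(* The index [i] stands for the degree [i.+1], as [leaf_pairs_whp] requires a positive degree. *)
pose bad n := \sum_(i < K) (
   Ex n (fun x => (n%:R * A i.+1
     <= #|deg_class (graph_of x) i.+1|%:R :> R)%R%:R)
 + Ex n (fun x => (n%:R * B i.+1
   <= #|leaf_pairs (graph_of x) i.+1|%:R :> R)%R%:R)).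
have bad0 : bad @ \oo --> \sum_(i < K) (0 + 0 : R).
  apply: cvg_sumr => i _; apply: cvgD; first exact: deg_class_whp.
  exact: leaf_pairs_whp.
rewrite big1 ?addr0// in bad0.
near=> n.
have n0 : (0 < n)%N by near: n; exact: nbhs_infty_gt.
have nR0 : 0 < n%:R :> R by rewrite ltr0n.
have p01n := p01 n n0.
have badn : bad n <= eta / 2.
  by near: n; apply: cvgr_le bad0 _ _; rewrite divr_gt0.
have taun : Ex n (fun x => (n%:R * tau
     <= (\sum_u 'C(deg (graph_of x) u, 2))%:R :> R)%R%:R) <= eta / 2.
  by near: n; apply: (pairs_of_nbrs_whp p01 np_lambda tau0 lam_tau).
have le1 : Ex n (fun x => (energy R (graph_of x) / n%:R
    <= energy_bound lambda + eps)%R%:R) <= 1.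
  rewrite -[leRHS](bern_exp_cst (p n) (enum (vertex_pairs n))).
  by apply: ler_bern_exp => // x; rewrite (ler_nat _ _ 1) leq_b1.
rewrite ger0_norm ?subr_ge0// lerBlDr.
apply: (@le_trans _ _ (bad n + Ex n (fun x => (n%:R * tau
     <= (\sum_u 'C(deg (graph_of x) u, 2))%:R :> R)%R%:R)
  + Ex n (fun x => (energy R (graph_of x) / n%:R
    <= energy_bound lambda + eps)%R%:R)));
      last by rewrite lerD2r [eta]splitr lerD.
under [bad n]eq_bigr do rewrite -bern_expD.
rewrite /bad -bern_exp_sum -!bern_expD.
rewrite -[leLHS](bern_exp_cst (p n) (enum (vertex_pairs n))).
(* Pointwise, one of the indicators equals 1: a count is too large, the sum of binomials is too
   large, or the energy bound holds. *)
apply: ler_bern_exp => // x.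
set good := _ <= _ + eps.
have [[i AB]|/forallNP nAB] := pselect (exists i : 'I_K,
     n%:R * A i.+1 <= #|deg_class (graph_of x) i.+1|%:R :> R \/
     n%:R * B i.+1 <= #|leaf_pairs (graph_of x) i.+1|%:R :> R).
  rewrite (bigD1 i)//= -!addrA addrA ler_wpDr//.
    by rewrite !addr_ge0// sumr_ge0// => j _; rewrite addr_ge0.
  by case: AB => ->; rewrite ?lerDl ?lerDr.
have [_|nT] := lerP (n%:R * tau) (\sum_u 'C(deg (graph_of x) u, 2))%:R.
  by rewrite addrAC ler_wpDl// addr_ge0// sumr_ge0// => j _; rewrite addr_ge0.
have -> : good.
  rewrite /good ler_pdivrMr// mulrC.
  have hA k : (0 < k < K)%N -> #|deg_class (graph_of x) k|%:R <= n%:R * A k.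
    case: k => // k /andP[_ kK]; rewrite leNgt; apply/negP => /ltW H.
    by apply: (nAB (Ordinal (ltnW kK))); left.
  have hB k : (0 < k < K)%N -> #|leaf_pairs (graph_of x) k|%:R <= n%:R * B k.
    case: k => // k /andP[_ kK]; rewrite leNgt; apply/negP => /ltW H.
    by apply: (nAB (Ordinal (ltnW kK))); right.
  apply: le_trans (energy_le_of_counts K1 hA hB (ltW nT)) _.
  rewrite ler_wpM2l// [eps]splitr addrA; exact: lerD.
by rewrite ler_wpDl// addr_ge0// sumr_ge0// => j _; rewrite addr_ge0.
Unshelve. all: by end_near. Qed.

Theorem theorem8 (R : realType) (lambda : R) (lambda_gt0 : 0 < lambda)
    (p : nat -> R)
    (p01 : forall n : nat, (0 < n)%N -> 0 <= p n <= 1)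
    (np_lambda : (fun n : nat => n%:R * p n) @ \oo --> lambda)
    (d : nat -> measure_display)
    (T : forall n : nat, measurableType (d n))
    (P : forall n : nat, probability (T n) R)
    (G : forall n : nat, T n -> sgraph n)
    (G_Gnp : forall n : nat, (0 < n)%N -> is_Gnp (P n) (p n) (@G n))
    (eps : R) (eps_gt0 : 0 < eps) :
  (fun n : nat =>
     P n [set w | energy R (G n w) / n%:R <= energy_bound lambda + eps])
    @ \oo --> 1%E.
Proof.
have lim := energy_graph_of_whp lambda_gt0 p01 np_lambda eps_gt0.
have {}lim : (fun n => (bern_exp (p n) (enum (vertex_pairs n))
     (fun x => (energy R (graph_of x) / n%:R <= energy_bound lambda + eps)%R
       %:R))%:E)
  @ \oo --> 1%E.
  by apply: cvg_EFin lim; exact: nearW.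
(* For n > 0 the two sequences agree exactly, because the energy depends only on the set of edges
   that occur. *)
apply: cvg_trans lim; apply: near_eq_cvg; near=> n.
have n0 : (0 < n)%N by near: n; exact: nbhs_infty_gt.
rewrite -(prob_graph_property (fun x => energy R (graph_of x) / n%:R
  <= energy_bound lambda + eps) (G_Gnp n n0)).
congr (P n _); apply/funext => w /=.
by rewrite (energy_eq_adj R (graph_of_occurring (@G n) w)).
Unshelve. all: by end_near. Qed.
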